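(* Let $n\geq 2$ and $T\in M_{n}(\mathbb{C})$, and let $\mathcal{A}_{T}$ be the norm-closed subalgebra of $M_n(\mathbb{C})=B(\mathbb{C}^n)$ generated by $T$ and the identity $I$. The following statements are equivalent: (i) $\mathcal{A}_{T}$ is a zero product determined Banach algebra. (ii) Every bounded local derivation from $\mathcal{A}_{T}$ into any Banach $\mathcal{A}_{T}$-bimodule $\mathcal{M}$ is a derivation. (iii) Every bounded local left (respectively, right) multiplier from $\mathcal{A}_{T}$ into any Banach $\mathcal{A}_{T}$-bimodule $\mathcal{M}$ is a left (respectively, right) multiplier. (iv) $T$ is diagonalizable.
   Context: A Banach algebra $\mathcal{A}$ is zero product determined if for every continuous bilinear functional $\varphi:\mathcal{A}\times\mathcal{A}\to\mathbb{C}$ such that $\varphi(x,y)=0$ whenever $xy=0$, there is a continuous linear functional $\tau$ on $\mathcal{A}$ with $\varphi(x,y)=\tau(xy)$ for all $x,y\in\mathcal{A}$. Banach bimodules are not assumed to be unital. Let $\mathcal{M}$ be a Banach $\mathcal{A}$-bimodule. A linear map $\delta:\mathcal{A}\to\mathcal{M}$ is a derivation if $\delta(xy)=\delta(x)\cdot y+x\cdot\delta(y)$ for all $x,y\in\mathcal{A}$; it is a local derivation if for every $x\in\mathcal{A}$ there is a derivation $\delta_x:\mathcal{A}\to\mathcal{M}$ with $\delta(x)=\delta_x(x)$. A linear map $V:\mathcal{A}\to\mathcal{M}$ is a left (respectively, right) multiplier if $V(ab)=V(a)\cdot b$ (respectively, $V(ab)=a\cdot V(b)$) for all $a,b\in\mathcal{A}$;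 it is a local left (respectively, right) multiplier if for every $a\in\mathcal{A}$ there is a left (respectively, right) multiplier $V_a:\mathcal{A}\to\mathcal{M}$ with $V(a)=V_a(a)$. *)

(* Defs.v *)
From HB Require Import structures.
From mathcomp Require Import all_boot all_order all_algebra.
From mathcomp Require Import complex ring lra.
From mathcomp Require Import all_classical all_reals all_analysis.

Set Implicit Arguments.
Unset Strict Implicit.
Unset Printing Implicit Defensive.

Import Order.TTheory GRing.Theory Num.Theory.
Import numFieldNormedType.Exports.

Local Open Scope classical_set_scope.
Local Open Scope ring_scope.

(* The product is a separate operation, not the one of [GRing.Algebra], because
   Banach algebras need not have a unit. *)
HB.mixin Record CompleteNormedModule_isBanachAlgebra (K : numFieldType) A
    & CompleteNormedModule K A := {
  bmul : A -> A -> A ;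
  bmulA : associative bmul ;
  bmul_linearl : forall y, linear (bmul ^~ y) ;
  bmul_linearr : forall x, linear (bmul x) ;
  norm_bmul : forall x y, `|bmul x y| <= `|x| * `|y|
}.

#[short(type="banachAlgType")]
HB.structure Definition BanachAlgebra (K : numFieldType) :=
  {A of CompleteNormedModule K A & CompleteNormedModule_isBanachAlgebra K A}.

Notation "x *b y" := (bmul x y) (at level 40, left associativity) : ring_scope.

(* The actions are jointly bounded, with a constant that need not be 1.
   No unitality is required, even when [A] has a unit. *)
HB.mixin Record CompleteNormedModule_isBanachBimodule (K : numFieldType)
    (A : banachAlgType K) M & CompleteNormedModule K M := {
  lact : A -> M -> M ;
  ract : M -> A -> M ;
  lact_linearl : forall m, linear (lact ^~ m) ;
  lact_linearr : forall a, linear (lact a) ;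
  ract_linearl : forall a, linear (ract ^~ a) ;
  ract_linearr : forall m, linear (ract m) ;
  lactA : forall a b m, lact (a *b b) m = lact a (lact b m) ;
  ractA : forall m a b, ract m (a *b b) = ract (ract m a) b ;
  lractA : forall a m b, ract (lact a m) b = lact a (ract m b) ;
  norm_act : exists k : K, forall a m,
    `|lact a m| <= k * `|a| * `|m| /\ `|ract m a| <= k * `|a| * `|m|
}.

#[short(type="banachBimodType")]
HB.structure Definition BanachBimodule (K : numFieldType)
    (A : banachAlgType K) :=
  {M of CompleteNormedModule K M & CompleteNormedModule_isBanachBimodule K A M}.

Section Notions.
Context {K : numFieldType} (A : banachAlgType K).

Definition zero_product_determined :=
  forall phi : A -> A -> K^o,
    (forall y, linear (phi ^~ y)) -> (forall x, linear (phi x)) ->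
    continuous (fun p : A * A => phi p.1 p.2) ->
    (forall x y, x *b y = 0 -> phi x y = 0) ->
  exists tau : A -> K^o,
    [/\ linear tau, continuous tau & forall x y, phi x y = tau (x *b y)].

Definition bounded_operator (V W : normedModType K) (f : V -> W) :=
  exists k : K, forall x, `|f x| <= k * `|x|.

Context (M : banachBimodType A).

Definition derivation (d : A -> M) :=
  linear d /\ forall x y, d (x *b y) = ract (d x) y + lact x (d y).

Definition local_derivation (d : A -> M) :=
  linear d /\ forall x, exists2 dx, derivation dx & d x = dx x.

Definition left_multiplier (V : A -> M) :=
  linear V /\ forall a b, V (a *b b) = ract (V a) b.

Definition local_left_multiplier (V : A -> M) :=
  linear V /\ forall a, exists2 Va, left_multiplier Va & V a = Va a.

Definition right_multiplier (V : A -> M) :=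
  linear V /\ forall a b, V (a *b b) = lact a (V b).

Definition local_right_multiplier (V : A -> M) :=
  linear V /\ forall a, exists2 Va, right_multiplier Va & V a = Va a.

End Notions.

Section ClosedSubalgebra.
Context {K : numFieldType} (A : banachAlgType K).

Definition closed_subalgebra (S : set A) :=
  [/\ closed S, S 0, forall (k : K) x y, S x -> S y -> S (k *: x + y)
    & forall x y, S x -> S y -> S (x *b y)].

Lemma smallest_closed_subalgebra (G : set A) :
  closed_subalgebra (smallest closed_subalgebra G).
Proof.
split.
- by apply: closed_bigI => S [[]].
- by move=> S [[]].
- by move=> k x y Sx Sy S SG; case: (SG) => -[_ _ + _] _; apply; [exact: Sx|exact: Sy].
- by move=> x y Sx Sy S SG; case: (SG) => -[_ _ _ +] _; apply; [exact: Sx|exact: Sy].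
Qed.

Record closedSubalgebra := ClosedSubalgebra {
  subalg_set :> set A ;
  subalg_closed : closed_subalgebra subalg_set
}.

Definition generated (G : set A) : closedSubalgebra :=
  ClosedSubalgebra (smallest_closed_subalgebra G).

Variable S : closedSubalgebra.

Definition subalg_pred : {pred A} := fun x => `[< subalg_set S x >].

Lemma subalg_submod : GRing.subsemimod_closed subalg_pred.
Proof.
case: (subalg_closed S) => _ S0 Slin _.
have SZ k x : subalg_set S x -> subalg_set S (k *: x) by move=> Sx; rewrite -[_ *: _]addr0; apply: Slin.
split; first split.
- exact/asboolP.
- move=> x y /asboolP Sx /asboolP Sy; apply/asboolP.
  by rewrite -[x]scale1r; apply: Slin.
- by move=> k x /asboolP Sx; apply/asboolP/SZ.
Qed.

HB.instance Definition _ := GRing.isSubmodClosed.Build K A subalg_pred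
  subalg_submod.

Record subalg : Type := Subalg { subalg_val : A ; _ : subalg_val \in subalg_pred }.

HB.instance Definition _ := [isSub for subalg_val].
HB.instance Definition _ := [Choice of subalg by <:].
HB.instance Definition _ := [SubChoice_isSubLmodule of subalg by <:].

Let nrm (x : subalg) : K := `|val x|.

Let nrmD x y : nrm (x + y) <= nrm x + nrm y.
Proof. by rewrite /nrm raddfD ler_normD. Qed.

Let nrmZ (l : K) x : nrm (l *: x) = `|l| * nrm x.
Proof. by rewrite /nrm linearZ normrZ. Qed.

Let nrm_eq0 x : nrm x = 0 -> x = 0.
Proof. by move/normr0_eq0 => x0; apply/val_inj; rewrite x0 raddf0. Qed.

HB.instance Definition _ := @Lmodule_isNormed.Build K subalg
  nrm nrmD nrmZ nrm_eq0.

Lemma subalg_normE (x : subalg) : `|x| = `|val x|. Proof. by []. Qed.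

Lemma subalg_complete (F : set_system subalg) :
  ProperFilter F -> cauchy F -> cvg F.
Proof.
move=> FF cF.
have Fv : ProperFilter (val @ F) by exact: fmap_proper_filter.
have cv : cvg (val @ F).
  apply: cauchy_cvg; apply/cauchyP => e e0.
  have /cauchyP/(_ e e0)[x Fx] := cF.
  exists (val x); rewrite -ball_normE /=.
  by apply: filterS Fx => y; rewrite -ball_normE /= subalg_normE raddfB.
have Sl : subalg_set S (lim (val @ F)).
  case: (subalg_closed S) => clS _ _ _.
  apply: (closed_cvg (subalg_set S) clS _ _ cv).
  by apply: filterE => x; have /asboolP := valP x.
have Pl : lim (val @ F) \in subalg_pred by exact/asboolP.
apply/cvg_ex; exists (Subalg Pl).
apply/cvgrPdist_lt => e e0.
have /cvgrPdist_lt/(_ e e0) := cv.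
apply: filterS => y.
by rewrite subalg_normE raddfB.
Qed.

HB.instance Definition _ := Uniform_isComplete.Build subalg subalg_complete.

End ClosedSubalgebra.
Section SubalgAlgebra.
Context {K : numFieldType} (A : banachAlgType K) (S : closedSubalgebra A).

Lemma subalg_mul_subproof (x y : subalg S) : val x *b val y \in subalg_pred S.
Proof.
case: (subalg_closed S) => _ _ _ SM.
have /asboolP Sx := valP x; have /asboolP Sy := valP y.
by apply/asboolP; exact: SM.
Qed.

Definition subalg_mul (x y : subalg S) : subalg S :=
  Subalg (subalg_mul_subproof x y).

Let mulA : associative subalg_mul.
Proof. by move=> x y z; apply/val_inj; rewrite /= bmulA. Qed.

Let mul_linearl y : linear (subalg_mul ^~ y).
Proof.
move=> k x z; apply/val_inj.
exact: (bmul_linearl (val y)).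
Qed.

Let mul_linearr x : linear (subalg_mul x).
Proof.
move=> k y z; apply/val_inj.
exact: (bmul_linearr (val x)).
Qed.

Let norm_mul (x y : subalg S) : `|subalg_mul x y| <= `|x| * `|y|.
Proof. by rewrite !subalg_normE; exact: norm_bmul. Qed.

HB.instance Definition _ := CompleteNormedModule_isBanachAlgebra.Build K (subalg S)
  mulA mul_linearl mul_linearr norm_mul.

End SubalgAlgebra.

Section EuclideanNorm.
Context {R : realType}.
Local Notation C := R[i].
Import ComplexField.Normc.

Definition l2norm n (v : 'cV[C]_n) : R :=
  Num.sqrt (\sum_i normc (v i 0) ^+ 2).

Definition opnorm n (X : 'M[C]_n) : R :=
  sup [set l2norm (X *m v) | v in [set v | l2norm v <= 1]].

Lemma normc_ge0 (x : C) : 0 <= normc x.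
Proof. by case: x => a b; exact: sqrtr_ge0. Qed.

Lemma sum_sqr_ge0 (I : finType) (f : I -> R) : 0 <= \sum_i f i ^+ 2.
Proof. by apply: sumr_ge0 => i _; exact: sqr_ge0. Qed.

Lemma sum_sqr_eq0 (I : finType) (f : I -> R) :
  \sum_i f i ^+ 2 <= 0 -> forall i, f i = 0.
Proof.
move=> f0 i.
have /eqP : \sum_i f i ^+ 2 = 0 by apply/eqP; rewrite eq_le f0 sum_sqr_ge0.
rewrite psumr_eq0 => [/allP/(_ i)|j _]; last exact: sqr_ge0.
by rewrite mem_index_enum sqrf_eq0 => /(_ isT)/eqP.
Qed.

Lemma cauchy_schwarz_sum (I : finType) (f g : I -> R) :
  \sum_i f i * g i <= Num.sqrt (\sum_i f i ^+ 2) * Num.sqrt (\sum_i g i ^+ 2).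
Proof.
have [f0|/sum_sqr_eq0 f0] := ltP 0 (\sum_i f i ^+ 2); last first.
  rewrite big1 => [|i _]; last by rewrite f0 mul0r.
  by rewrite mulr_ge0 ?sqrtr_ge0.
have [g0|/sum_sqr_eq0 g0] := ltP 0 (\sum_i g i ^+ 2); last first.
  rewrite big1 => [|i _]; last by rewrite g0 mulr0.
  by rewrite mulr_ge0 ?sqrtr_ge0.
set s := Num.sqrt (\sum_i f i ^+ 2); set t := Num.sqrt _.
have sE : \sum_i f i ^+ 2 = s ^+ 2 by rewrite sqr_sqrtr ?ltW.
have tE : \sum_i g i ^+ 2 = t ^+ 2 by rewrite sqr_sqrtr ?ltW.
have s0 : 0 < s by rewrite sqrtr_gt0.
have t0 : 0 < t by rewrite sqrtr_gt0.
have : 0 <= \sum_i (t * f i - s * g i) ^+ 2 by exact: sum_sqr_ge0.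
have -> : \sum_i (t * f i - s * g i) ^+ 2 =
    t ^+ 2 * (\sum_i f i ^+ 2) + s ^+ 2 * (\sum_i g i ^+ 2)
    - (s * t * (\sum_i f i * g i)) *+ 2.
  rewrite !mulr_sumr -sumrMnl -sumrN -!big_split; apply: eq_bigr => i _ /=.
  ring.
rewrite sE tE => h.
have {}h : 0 <= s * t * (s * t - \sum_i f i * g i) by lra.
by rewrite -subr_ge0 -(pmulr_rge0 _ (mulr_gt0 s0 t0)).
Qed.

Lemma minkowski_sum (I : finType) (f g : I -> R) :
  Num.sqrt (\sum_i (f i + g i) ^+ 2) <=
  Num.sqrt (\sum_i f i ^+ 2) + Num.sqrt (\sum_i g i ^+ 2).
Proof.
rewrite -(@ler_pXn2r _ 2)// ?nnegrE ?addr_ge0 ?sqrtr_ge0//.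
rewrite sqr_sqrtr ?sum_sqr_ge0// sqrrD !sqr_sqrtr ?sum_sqr_ge0//.
under eq_bigr => i _ do rewrite sqrrD.
rewrite big_split big_split/= sumrMnl lerD2r lerD2l lerMn2r/=.
exact: cauchy_schwarz_sum.
Qed.

Section Vectors.
Context {n : nat}.
Implicit Types v w : 'cV[C]_n.

Lemma l2norm_ge0 v : 0 <= l2norm v. Proof. exact: sqrtr_ge0. Qed.

Lemma l2normD v w : l2norm (v + w) <= l2norm v + l2norm w.
Proof.
apply: le_trans (minkowski_sum _ _).
apply: ler_wsqrtr; apply: ler_sum => i _; rewrite mxE.
by rewrite ler_pXn2r ?nnegrE ?addr_ge0 ?normc_ge0// le_normcD.
Qed.

Lemma l2normZ (k : C) v : l2norm (k *: v) = normc k * l2norm v.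
Proof.
rewrite /l2norm; under eq_bigr => i _ do rewrite mxE normcM exprMn.
by rewrite -mulr_sumr sqrtrM ?sqr_ge0// sqrtr_sqr ger0_norm ?normc_ge0.
Qed.

Lemma normc_le_l2norm v i : normc (v i 0) <= l2norm v.
Proof.
rewrite -[leLHS]ger0_norm ?normc_ge0// -sqrtr_sqr; apply: ler_wsqrtr.
by rewrite (bigD1 i)//= lerDl; apply: sumr_ge0 => j _; exact: sqr_ge0.
Qed.

Lemma l2norm_le_sum v : l2norm v <= \sum_i normc (v i 0).
Proof.
have s0 : 0 <= \sum_i normc (v i 0) by apply: sumr_ge0 => i _; exact: normc_ge0.
rewrite -[leRHS]ger0_norm// -sqrtr_sqr; apply: ler_wsqrtr.
rewrite expr2 mulr_suml; apply: ler_sum => i _.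
rewrite expr2 ler_wpM2l ?normc_ge0// (bigD1 i)//= lerDl.
by apply: sumr_ge0 => j _; exact: normc_ge0.
Qed.

Lemma l2norm_eq0 v : l2norm v = 0 -> v = 0.
Proof.
move=> v0; apply/matrixP => i j; rewrite (ord1 j) mxE; apply: eq0_normc.
by apply/eqP; rewrite eq_le normc_ge0 andbT -v0 normc_le_l2norm.
Qed.

Lemma l2norm0 : l2norm (0 : 'cV[C]_n) = 0.
Proof. by rewrite -(scale0r (0 : 'cV[C]_n)) l2normZ normc0 mul0r. Qed.

End Vectors.

Section OperatorNorm.
Context {n : nat}.
Implicit Types (v w : 'cV[C]_n) (X Y : 'M[C]_n).

Lemma normc_sum (I : finType) (f : I -> C) :
  normc (\sum_i f i) <= \sum_i normc (f i).
Proof.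
elim/big_ind2: _ => [|x y z t h1 h2|//]; first by rewrite normc0.
exact: le_trans (le_normcD _ _) (lerD h1 h2).
Qed.

Let entries X := \sum_i \sum_j normc (X i j).

Lemma l2norm_mulmx_entries X v : l2norm (X *m v) <= entries X * l2norm v.
Proof.
apply: le_trans (l2norm_le_sum _) _; rewrite mulr_suml; apply: ler_sum => i _.
rewrite mxE mulr_suml; apply: le_trans (normc_sum _) _; apply: ler_sum => j _.
by rewrite normcM ler_wpM2l ?normc_ge0 ?normc_le_l2norm.
Qed.

Lemma opnorm_has_sup X :
  has_sup [set l2norm (X *m v) | v in [set v | l2norm v <= 1]].
Proof.
split; first by exists (l2norm (X *m 0)), 0; rewrite //= l2norm0 ler01.
exists (entries X) => _ [v /= v1 <-]; apply: le_trans (l2norm_mulmx_entries _ _) _.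
rewrite ler_piMr//; apply: sumr_ge0 => i _; apply: sumr_ge0 => j _.
exact: normc_ge0.
Qed.

Lemma opnorm_le X (c : R) :
  (forall v, l2norm v <= 1 -> l2norm (X *m v) <= c) -> opnorm X <= c.
Proof.
move=> h; apply: ge_sup; first by case: (opnorm_has_sup X).
by move=> _ [v /= /h ? <-].
Qed.

Lemma opnorm_ge0 X : 0 <= opnorm X.
Proof.
apply: le_trans (l2norm_ge0 (X *m 0)) _; apply: sup_upper_bound.
  exact: opnorm_has_sup.
by exists 0; rewrite //= l2norm0 ler01.
Qed.

Lemma l2norm_mulmx X v : l2norm (X *m v) <= opnorm X * l2norm v.
Proof.
have [v0|v0] := eqVneq (l2norm v) 0.
  by rewrite (l2norm_eq0 v0) mulmx0 l2norm0 mulr0.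
have {}v0 : 0 < l2norm v by rewrite lt_neqAle eq_sym v0 l2norm_ge0.
rewrite -ler_pdivrMr// mulrC.
have nV : normc ((l2norm v)^-1%:C)%C = (l2norm v)^-1.
  by rewrite /normc/= expr0n addr0 sqrtr_sqr ger0_norm// invr_ge0 ltW.
rewrite -{1}nV -l2normZ scalemxAr; apply: sup_upper_bound.
  exact: opnorm_has_sup.
by exists ((l2norm v)^-1%:C%C *: v); rewrite //= l2normZ nV mulVf ?gt_eqF.
Qed.

Lemma opnormD X Y : opnorm (X + Y) <= opnorm X + opnorm Y.
Proof.
apply: opnorm_le => v v1; rewrite mulmxDl; apply: le_trans (l2normD _ _) _.
by apply: lerD; apply: le_trans (l2norm_mulmx _ _) _; rewrite ler_piMr ?opnorm_ge0.
Qed.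

Lemma opnormM X Y : opnorm (X *m Y) <= opnorm X * opnorm Y.
Proof.
apply: opnorm_le => v v1; rewrite -mulmxA; apply: le_trans (l2norm_mulmx _ _) _.
rewrite ler_wpM2l ?opnorm_ge0//; apply: le_trans (l2norm_mulmx _ _) _.
by rewrite ler_piMr ?opnorm_ge0.
Qed.

Lemma opnormZ_le (k : C) X : opnorm (k *: X) <= normc k * opnorm X.
Proof.
apply: opnorm_le => v v1; rewrite -scalemxAl l2normZ.
rewrite ler_wpM2l ?normc_ge0//; apply: le_trans (l2norm_mulmx _ _) _.
by rewrite ler_piMr ?opnorm_ge0.
Qed.

Lemma opnormZ (k : C) X : opnorm (k *: X) = normc k * opnorm X.
Proof.
apply/eqP; rewrite eq_le opnormZ_le/=.
have [->|k0] := eqVneq k 0; first by rewrite normc0 mul0r opnorm_ge0.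
have nk : 0 < normc k.
  rewrite lt_neqAle normc_ge0 andbT eq_sym.
  by apply: contra k0 => /eqP/eq0_normc ->.
have := opnormZ_le k^-1 (k *: X).
by rewrite scalerA mulVf// scale1r normcV mulrC ler_pdivlMr// mulrC.
Qed.

Lemma normc_le_opnorm X i j : normc (X i j) <= opnorm X.
Proof.
have l2d : l2norm (delta_mx j 0 : 'cV[C]_n) = 1.
  rewrite /l2norm (bigD1 j)//= big1 => [|k /negPf kj]; last first.
    by rewrite mxE kj normc0 expr0n.
  by rewrite mxE !eqxx normc1 expr1n addr0 sqrtr1.
have -> : X i j = (X *m (delta_mx j 0 : 'cV[C]_n)) i 0.
  rewrite mxE (bigD1 j)//= big1 => [|k /negPf kj]; last first.
    by rewrite mxE kj mulr0.
  by rewrite mxE !eqxx mulr1 addr0.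
apply: le_trans (normc_le_l2norm _ _) _.
by have := l2norm_mulmx X (delta_mx j 0 : 'cV[C]_n); rewrite l2d mulr1.
Qed.

Lemma opnorm_le_entries X : opnorm X <= \sum_i \sum_j normc (X i j).
Proof.
apply: opnorm_le => v v1; apply: le_trans (l2norm_mulmx_entries _ _) _.
rewrite ler_piMr//; apply: sumr_ge0 => i _; apply: sumr_ge0 => j _.
exact: normc_ge0.
Qed.

Lemma opnorm_eq0 X : opnorm X = 0 -> X = 0.
Proof.
move=> X0; apply/matrixP => i j; rewrite mxE; apply: eq0_normc.
by apply/eqP; rewrite eq_le normc_ge0 andbT -X0 normc_le_opnorm.
Qed.

End OperatorNorm.
End EuclideanNorm.

(* [B(C^n)] for the Euclidean norm on C^n. An alias of the matrix type is needed
   because the library norms ['M_n] by the largest modulus of an entry. *)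
Definition opmx (R : realType) (n : nat) : Type := 'M[R[i]]_n.

Section OperatorMatrix.
Context {R : realType} {n : nat}.
Local Notation C := R[i].
Local Notation B := (opmx R n).
Import ComplexField.Normc.

HB.instance Definition _ := GRing.Lmodule.copy B 'M[C]_n.

Let nrm (X : B) : C := (opnorm X)%:C%C.

Let nrmD (X Y : B) : nrm (X + Y) <= nrm X + nrm Y.
Proof. by rewrite /nrm -rmorphD/= lecR; exact: opnormD. Qed.

Let nrmZ (k : C) (X : B) : nrm (k *: X) = `|k| * nrm X.
Proof. by rewrite /nrm opnormZ rmorphM/=; case: k. Qed.

Let nrm_eq0 (X : B) : nrm X = 0 -> X = 0.
Proof. by move=> /complexI; exact: opnorm_eq0. Qed.

HB.instance Definition _ := @Lmodule_isNormed.Build C B nrm nrmD nrmZ nrm_eq0.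

Lemma opmx_normE (X : B) : `|X| = (opnorm X)%:C%C. Proof. by []. Qed.

Lemma opmx_complete (F : set_system B) :
  ProperFilter F -> cauchy F -> cvg F.
Proof.
move=> FF cF.
have cE (f : C -> R) : (forall x y, `|f x - f y| <= normc (x - y)) ->
    forall i j, cvg ((fun X : B => f (X i j)) @ F).
  move=> fle i j; apply: (@cauchy_cvg R^o); apply/cauchyP => e e0.
  have eC : 0 < e%:C%C :> C by rewrite ltcR.
  have /cauchyP/(_ _ eC)[X FX] := cF.
  exists (f ((X : B) i j)); rewrite -ball_normE /=.
  move: FX; rewrite -ball_normE; apply: filterS => Y.
  rewrite /= opmx_normE ltcR; apply: le_lt_trans.
  apply: le_trans (fle _ _) _.
  by have := normc_le_opnorm (X - Y : 'M[C]_n) i j; rewrite !mxE.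
have Rele (x y : C) : `|complex.Re x - complex.Re y| <= normc (x - y).
  rewrite -raddfB; case: (x - y) => a b /=.
  by rewrite -sqrtr_sqr ler_wsqrtr// lerDl sqr_ge0.
have Imle (x y : C) : `|complex.Im x - complex.Im y| <= normc (x - y).
  rewrite -raddfB; case: (x - y) => a b /=.
  by rewrite -sqrtr_sqr ler_wsqrtr// lerDr sqr_ge0.
pose lf f i j := lim ((fun X : B => f (X i j) : R) @ F).
pose L : B := \matrix_(i, j) (lf (@complex.Re R) i j +i* lf (@complex.Im R) i j)%C.
have normc_ReIm (x : C) : normc x <= `|complex.Re x| + `|complex.Im x|.
  have -> : x = ((complex.Re x)%:C + (0 +i* complex.Im x))%C.
    by case: x => a b; apply/eqP; rewrite eq_complex /= addr0 add0r !eqxx.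
  by apply: le_trans (le_normcD _ _) _; rewrite /= !expr0n !addr0 !add0r !sqrtr_sqr.
apply/cvg_ex; exists L; apply/cvgrPdist_lt => e e0.
have [e' e'0 eE] : exists2 e', 0 < e' & e = (e' : R)%:C%C.
  move: e0; case: e => a b; rewrite ltcE/= => /andP[/eqP b0 a0].
  by exists a => //; rewrite b0.
subst e.
pose d := e' / ((n * n).*2.+1)%:R.
have d0 : 0 < d by rewrite divr_gt0.
have near_f (f : C -> R) : (forall x y, `|f x - f y| <= normc (x - y)) ->
    \forall X \near F, forall i j, `|lf f i j - f ((X : B) i j)| < d.
  move=> fle; apply: filter_forall => i; apply: filter_forall => j.
  by have /cvgrPdist_lt := cE f fle i j; exact.
apply: filterS (filterI (near_f _ Rele) (near_f _ Imle)) => X [reX imX].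
rewrite opmx_normE ltcR; apply: le_lt_trans (opnorm_le_entries _) _.
apply: (@le_lt_trans _ _ (\sum_(i < n) \sum_(j < n) (d + d))).
  apply: ler_sum => i _; apply: ler_sum => j _.
  apply: le_trans (normc_ReIm _) _; rewrite !mxE !raddfB/=.
  by apply: lerD; apply/ltW.
rewrite !sumr_const !card_ord -mulr2n -!mulrnA mul2n.
rewrite /d -[ltLHS]mulr_natr -mulrA gtr_pMr// mulrC ltr_pdivrMr// mul1r ltr_nat.
by [].
Qed.

HB.instance Definition _ := Uniform_isComplete.Build B opmx_complete.

Let mulA : associative (@mulmx C n n n : B -> B -> B).
Proof. exact: mulmxA. Qed.

Let mul_linearl (Y : B) : linear ((@mulmx C n n n : B -> B -> B) ^~ Y).
Proof. by move=> k X Z; rewrite mulmxDl -scalemxAl. Qed.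

Let mul_linearr (X : B) : linear ((@mulmx C n n n : B -> B -> B) X).
Proof. by move=> k Y Z; rewrite mulmxDr -scalemxAr. Qed.

Let norm_mul (X Y : B) :
  `|(@mulmx C n n n : B -> B -> B) X Y| <= `|X| * `|Y|.
Proof. by rewrite !opmx_normE -rmorphM/= lecR; exact: opnormM. Qed.

HB.instance Definition _ := CompleteNormedModule_isBanachAlgebra.Build C B
  mulA mul_linearl mul_linearr norm_mul.

End OperatorMatrix.

Definition algebra_generated_by (R : realType) (n : nat) (T : 'M[R[i]]_n) :
    banachAlgType R[i] :=
  subalg (generated [set (T : opmx R n); (1%:M : opmx R n)]).

(* Main.v *)
Require Import Defs.
From HB Require Import structures.
From mathcomp Require Import all_boot all_order all_algebra.
From mathcomp Require Import complex.
From mathcomp Require Import all_classical all_reals all_analysis.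

Set Implicit Arguments.
Unset Strict Implicit.
Unset Printing Implicit Defensive.

Import Order.TTheory GRing.Theory Num.Theory.
Import numFieldNormedType.Exports.

Local Open Scope classical_set_scope.
Local Open Scope ring_scope.

(** The algebra A generated by T and I is the algebra C[T] of all polynomials
    in T: a finite-dimensional subspace is closed, so nothing is added by taking
    the norm closure ([generated_horner_mx]). Everything then depends on the
    minimal polynomial of T.

    If T is diagonalizable, its minimal polynomial divides a product of distinct
    linear factors, and Lagrange interpolation writes every element of A as a
    combination of idempotents ([diagonalizable_idempotent_span]). A unital
    Banach algebra spanned by idempotents is zero product determined, and its
    local multipliers and local derivations are multipliers and derivations, for
    a common reason: both sides of the wanted identity are linear in some
    element, which may therefore be taken to be an idempotent e, and then the
    complement 1 - e supplies the zero products e(1 - e) = (1 - e)e = 0 that the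
    hypothesis can be applied to ([idempotent_span_zpd],
    [idempotent_span_right_multiplier], [idempotent_span_derivation]).

    If T is not diagonalizable, some (x - a)^2 divides its minimal polynomial
    (x - a)^2 q. Put t = T - a, X = q(T) and Y = tX. Then Y is nonzero and
    tY = 0, so A acts on the ideal spanned by X and Y through the dual numbers:
    xX = chi(x) X + D(x) Y and xY = chi(x) Y, with chi a character and D a
    point derivation at chi ([not_diagonalizable_dual_numbers], [pderM]). The
    form chi(x) D(y) vanishes on zero products but takes different values at
    (1, t) and (t, 1), so A is not zero product determined
    ([dual_number_not_zpd]). The map x |-> D(x) Y from A to itself is a local
    multiplier: it sends x to x (D(x) / chi(x)) Y if chi(x) is nonzero, and to
    x X otherwise. It is not a multiplier, as it kills 1 and sends t to Y
    ([dual_number_right_multiplier]).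

    Over every Banach algebra, the statement about local derivations implies the
    one about local left multipliers: after the left action of a bimodule
    has been replaced by zero, its derivations are its left multipliers
    ([left_multiplier_derivation]). *)

(** * Bilinearity of products and actions *)

Section LinearFunctions.
Context {K : pzRingType} {U V : lmodType K} {f : U -> V} (fL : linear f).

Lemma linear_fun0 : f 0 = 0.
Proof. by have := fL (-1) 0 0; rewrite scaler0 addr0 scaleN1r addNr. Qed.

Lemma linear_funD x y : f (x + y) = f x + f y.
Proof. by rewrite -[x]scale1r fL !scale1r. Qed.

Lemma linear_funZ k x : f (k *: x) = k *: f x.
Proof. by rewrite -[k *: x]addr0 fL linear_fun0 addr0. Qed.

Lemma linear_funB x y : f (x - y) = f x - f y.
Proof. by rewrite linear_funD -scaleN1r linear_funZ scaleN1r. Qed.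

End LinearFunctions.

Section ProductLaws.
Context {K : numFieldType} {A : banachAlgType K}.
Implicit Types x y z : A.

Lemma bmulPl k x y z : (k *: x + y) *b z = k *: (x *b z) + y *b z.
Proof. exact: (bmul_linearl z). Qed.

Lemma bmulPr k x y z : z *b (k *: x + y) = k *: (z *b x) + z *b y.
Proof. exact: (bmul_linearr z). Qed.

Lemma bmul0r x : 0 *b x = 0. Proof. exact: linear_fun0 (bmul_linearl x). Qed.

Lemma bmulr0 x : x *b 0 = 0. Proof. exact: linear_fun0 (bmul_linearr x). Qed.

Lemma bmulDl x y z : (x + y) *b z = x *b z + y *b z.
Proof. exact: linear_funD (bmul_linearl z) _ _. Qed.

Lemma bmulDr x y z : z *b (x + y) = z *b x + z *b y.
Proof. exact: linear_funD (bmul_linearr z) _ _. Qed.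

Lemma bmulBl x y z : (x - y) *b z = x *b z - y *b z.
Proof. exact: linear_funB (bmul_linearl z) _ _. Qed.

Lemma bmulBr x y z : z *b (x - y) = z *b x - z *b y.
Proof. exact: linear_funB (bmul_linearr z) _ _. Qed.

Lemma bmulZl k x y : (k *: x) *b y = k *: (x *b y).
Proof. exact: linear_funZ (bmul_linearl y) _ _. Qed.

Lemma bmulZr k x y : x *b (k *: y) = k *: (x *b y).
Proof. exact: linear_funZ (bmul_linearr x) _ _. Qed.

End ProductLaws.

Section ActionLaws.
Context {K : numFieldType} {A : banachAlgType K} {M : banachBimodType A}.
Implicit Types (x y : A) (m p : M).

Lemma lactPl k x y m : lact (k *: x + y) m = k *: lact x m + lact y m.
Proof. exact: (lact_linearl m). Qed.

Lemma lactPr k x m p : lact x (k *: m + p) = k *: lact x m + lact x p.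
Proof. exact: (lact_linearr x). Qed.

Lemma ractPl k x y m : ract m (k *: x + y) = k *: ract m x + ract m y.
Proof. exact: (ract_linearr m). Qed.

Lemma ractPr k x m p : ract (k *: m + p) x = k *: ract m x + ract p x.
Proof. exact: (ract_linearl x). Qed.

Lemma lact0 x : lact x (0 : M) = 0. Proof. exact: linear_fun0 (lact_linearr x). Qed.

Lemma lact0l m : lact (0 : A) m = 0. Proof. exact: linear_fun0 (lact_linearl m). Qed.

Lemma ract0 m : ract m (0 : A) = 0. Proof. exact: linear_fun0 (ract_linearr m). Qed.

Lemma ract0l x : ract (0 : M) x = 0. Proof. exact: linear_fun0 (ract_linearl x). Qed.

Lemma lactDl x y m : lact (x + y) m = lact x m + lact y m.
Proof. exact: linear_funD (lact_linearl m) _ _. Qed.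

Lemma lactDr x m p : lact x (m + p) = lact x m + lact x p.
Proof. exact: linear_funD (lact_linearr x) _ _. Qed.

Lemma lactBr x m p : lact x (m - p) = lact x m - lact x p.
Proof. exact: linear_funB (lact_linearr x) _ _. Qed.

Lemma ractDr m x y : ract m (x + y) = ract m x + ract m y.
Proof. exact: linear_funD (ract_linearr m) _ _. Qed.

Lemma ractDl m p x : ract (m + p) x = ract m x + ract p x.
Proof. exact: linear_funD (ract_linearl x) _ _. Qed.

Lemma ractBl m p x : ract (m - p) x = ract m x - ract p x.
Proof. exact: linear_funB (ract_linearl x) _ _. Qed.

End ActionLaws.

(** * Algebras spanned by idempotents *)

Inductive idempotent_span {K : numFieldType} (A : banachAlgType K) : A -> Prop :=
| idempotent_span0 : idempotent_span 0
| idempotent_spanP k e x : e *b e = e -> idempotent_span x ->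
    idempotent_span (k *: e + x).

Section SpannedByIdempotents.
Context {K : numFieldType} {A : banachAlgType K}.
Variable u : A.
Hypotheses (mul1b : forall x, u *b x = x) (mulb1 : forall x, x *b u = x).
Hypothesis idemA : forall x : A, idempotent_span x.

Lemma eq_linear_idempotents (V : lmodType K) (f g : A -> V) :
  linear f -> linear g -> (forall e, e *b e = e -> f e = g e) -> f =1 g.
Proof.
move=> fL gL fg x; elim: (idemA x) => [|k e {}x ee _ IHx].
  by rewrite (linear_fun0 fL) (linear_fun0 gL).
by rewrite fL gL (fg e ee) IHx.
Qed.

Let subK e : e + (u - e) = u. Proof. by rewrite addrC subrK. Qed.

Lemma unit_splitl e x : x = e *b x + (u - e) *b x.
Proof. by rewrite -bmulDl subK mul1b. Qed.

Lemma unit_splitr e x : x = x *b e + x *b (u - e).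
Proof. by rewrite -bmulDr subK mulb1. Qed.

Lemma idem_complM e : e *b e = e -> e *b (u - e) = 0.
Proof. by move=> ee; rewrite bmulBr mulb1 ee subrr. Qed.

Lemma complM_idem e : e *b e = e -> (u - e) *b e = 0.
Proof. by move=> ee; rewrite bmulBl mul1b ee subrr. Qed.

Lemma idempotent_compl e : e *b e = e -> (u - e) *b (u - e) = u - e.
Proof. by move=> ee; rewrite bmulBl mul1b idem_complM// subr0. Qed.

(** For an idempotent e, phi(e, (1 - e)y) = 0 = phi(1 - e, ey), which gives
    phi(e, y) = phi(e, ey) = phi(1, ey). Hence phi(x, y) = phi(1, xy), and the
    functional is phi(1, .). *)
Lemma idempotent_span_zpd : zero_product_determined A.
Proof.
move=> phi phiLl phiLr phiC phi0; exists (phi u); split; first exact: phiLr.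
  move=> y; apply: (@continuous_comp _ _ _ (fun y : A => (u, y))
    (fun p : A * A => phi p.1 p.2)); last exact: phiC.
  by apply: cvg_pair; [exact: cvg_cst|exact: cvg_id].
move=> x y; move: x; apply: eq_linear_idempotents.
- exact: phiLl.
- by move=> k a b; rewrite bmulPl phiLr.
move=> e ee.
rewrite [in LHS](unit_splitl e y) (linear_funD (phiLr e)).
rewrite [phi e ((u - e) *b y)]phi0; last by rewrite bmulA idem_complM// bmul0r.
rewrite -[in RHS](subK e) (linear_funD (phiLl _)).
by rewrite [phi (u - e) _]phi0 // bmulA complM_idem// bmul0r.
Qed.

Section LocalMaps.
Context {M : banachBimodType A}.
Implicit Types (V d : A -> M).

(** Locality only says that V(eb) lies in eM, as the local multiplier at eb sends
    e(eb) to e times something; similarly V((1 - e)b) lies in (1 - e)M, which e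
    annihilates. Multiplying V(b) = V(eb) + V((1 - e)b) by e gives
    eV(b) = V(eb). *)
Lemma idempotent_span_right_multiplier V :
  local_right_multiplier V -> right_multiplier V.
Proof.
move=> [VL Vloc]; split=> // a b; move: a; apply: eq_linear_idempotents.
- by move=> k x y; rewrite bmulPl VL.
- by move=> k x y; rewrite lactPl.
have Videm e : e *b e = e -> V (e *b b) = lact e (V (e *b b)).
  move=> ee; have [W [_ Wmul] ->] := Vloc (e *b b).
  by rewrite -{1}ee -bmulA Wmul.
move=> e ee; rewrite (unit_splitl e b) (linear_funD VL) lactDr -(unit_splitl e b).
rewrite -Videm// (Videm (u - e) (idempotent_compl ee)) -lactA.
by rewrite idem_complM// lact0l addr0.
Qed.

Lemma idempotent_span_left_multiplier V :
  local_left_multiplier V -> left_multiplier V.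
Proof.
move=> [VL Vloc]; split=> // a; apply: eq_linear_idempotents.
- by move=> k x y; rewrite bmulPr VL.
- by move=> k x y; rewrite ractPl.
have Videm e : e *b e = e -> V (a *b e) = ract (V (a *b e)) e.
  move=> ee; have [W [_ Wmul] ->] := Vloc (a *b e).
  by rewrite -{1}ee bmulA Wmul.
move=> e ee; rewrite [in RHS](unit_splitr e a) (linear_funD VL) ractDl.
rewrite -Videm// (Videm (u - e) (idempotent_compl ee)) -ractA.
by rewrite complM_idem// ract0 addr0.
Qed.

Section LocalDerivation.
Variables (d : A -> M) (dloc : local_derivation d).

Let dL : linear d. Proof. by case: dloc. Qed.

(** If D is the derivation that agrees with d at y, then
    0 = D(xy)z = D(x)yz + xD(y)z = xD(y)z. *)
Lemma local_derivation_zero_products x y z :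
  x *b y = 0 -> y *b z = 0 -> ract (lact x (d y)) z = 0.
Proof.
move=> xy yz; have [D [DL Dder] ->] := dloc.2 y.
have := Dder x y; rewrite xy (linear_fun0 DL) => /esym/eqP.
rewrite addrC addr_eq0 => /eqP ->.
by rewrite -sub0r ractBl ract0l -ractA yz ract0 subr0.
Qed.

(** For an idempotent a, the two sides differ by a d((1 - a)y) z and
    (1 - a) d(ay) z, which vanish by [local_derivation_zero_products]. The unit
    of A stays visible because it need not act as the identity of M. *)
Lemma local_derivation_shiftl a y z : y *b z = 0 ->
  ract (lact a (d y)) z = ract (lact u (d (a *b y))) z.
Proof.
move=> yz; move: a; apply: eq_linear_idempotents.
- by move=> k x x'; rewrite lactPl ractPr.
- by move=> k x x'; rewrite bmulPl dL lactPr ractPr.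
move=> e ee; rewrite {1}(unit_splitl e y) (linear_funD dL) lactDr ractDl.
rewrite [X in _ + X]local_derivation_zero_products ?addr0; first last.
- by rewrite -bmulA yz bmulr0.
- by rewrite bmulA idem_complM// bmul0r.
rewrite -(subK e) lactDl ractDl.
rewrite [X in _ + X]local_derivation_zero_products ?addr0 //.
- by rewrite bmulA complM_idem// bmul0r.
- by rewrite -bmulA yz bmulr0.
Qed.

(** G(y) = a d(y) - 1 d(ay) is annihilated on the right by every z with yz = 0,
    by [local_derivation_shiftl]. For an idempotent b this gives
    G(y)b = G(yb)b = G(yb)1. *)
Lemma local_derivation_defect a b y :
  ract (lact a (d y) - lact u (d (a *b y))) b =
  ract (lact a (d (y *b b)) - lact u (d (a *b (y *b b)))) u.
Proof.
move: b; apply: eq_linear_idempotents.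
- by move=> k x x'; rewrite ractPl.
- move=> k x x'; rewrite !bmulPr !dL !lactPr -ractPr; congr ract.
  by rewrite scalerBr opprD addrACA.
move=> e ee.
have G0 x z : x *b z = 0 ->
    ract (lact a (d x) - lact u (d (a *b x))) z = 0.
  by move=> xz; rewrite ractBl (local_derivation_shiftl a xz) subrr.
have yc : y *b (u - e) *b e = 0 by rewrite -bmulA complM_idem// bmulr0.
have ye : y *b e *b (u - e) = 0 by rewrite -bmulA idem_complM// bmulr0.
have ractu m : ract m u = ract m e + ract m (u - e) by rewrite -ractDr subK.
rewrite [RHS]ractu (G0 _ _ ye) addr0 -[RHS]addr0 -(G0 _ _ yc) -ractDl.
congr ract; rewrite [in LHS](unit_splitr e y); set z := y *b (u - e).
by rewrite bmulDr !(linear_funD dL) !lactDr opprD addrACA.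
Qed.

(** A derivation satisfies D(1) = D(1)1 + 1D(1); multiplying by 1 on both sides
    gives 1D(1)1 = 2(1D(1)1). *)
Lemma local_derivation_compressed_unit a b : ract (lact a (d u)) b = 0.
Proof.
have [D [_ Dder] ->] := dloc.2 u.
have : ract (lact u (D u)) u = 0.
  have := congr1 (fun m => ract (lact u m) u) (Dder u u).
  rewrite mul1b /= lactDr ractDl -!lractA -!ractA -!lactA !mul1b.
  by move/eqP; rewrite -subr_eq0 opprD addNKr oppr_eq0 => /eqP.
move=> uDu; rewrite -(mulb1 a) -(mul1b b) lactA ractA [ract (lact a _) u]lractA.
by rewrite uDu lact0 ract0l.
Qed.

(** The derivation identity on the part 1M1 of M on which the unit acts as an
    identity: [local_derivation_defect] at y = 1. *)
Lemma local_derivation_compressed a b :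
  ract (lact u (d (a *b b))) u =
  ract (lact a (d b)) u + ract (lact u (d a)) b.
Proof.
have := local_derivation_defect a b u.
rewrite !mul1b mulb1 !ractBl local_derivation_compressed_unit sub0r => /eqP.
by rewrite eq_sym subr_eq addrC => /eqP ->; rewrite addrNK.
Qed.

End LocalDerivation.

(** As M need not be unital, it is split by the actions of the unit. For every
    derivation D, the map x |-> D(x) - 1D(x) is a left multiplier and
    x |-> D(x) - D(x)1 is a right one. Hence for a local derivation d these maps
    are local multipliers, and so multipliers. What is left of d is 1d(.)1,
    treated by [local_derivation_compressed]. *)
Lemma idempotent_span_derivation d : local_derivation d -> derivation d.
Proof.
move=> dloc; have [dL dd] := dloc.
have [_ Wmul] : left_multiplier (fun x => d x - lact u (d x)).
  apply: idempotent_span_left_multiplier; split.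
    by move=> k x y; rewrite dL lactPr scalerBr opprD addrACA.
  move=> x; have [D [DL Dder] Dx] := dd x.
  exists (fun y => D y - lact u (D y)); last by rewrite Dx.
  split=> [k y z|a b]; first by rewrite DL lactPr scalerBr opprD addrACA.
  rewrite Dder lactDr -lactA mul1b ractBl -lractA.
  by rewrite opprD addrACA subrr addr0.
have [_ Umul] : right_multiplier (fun x => d x - ract (d x) u).
  apply: idempotent_span_right_multiplier; split.
    by move=> k x y; rewrite dL ractPr scalerBr opprD addrACA.
  move=> x; have [D [DL Dder] Dx] := dd x.
  exists (fun y => D y - ract (D y) u); last by rewrite Dx.
  split=> [k y z|a b]; first by rewrite DL ractPr scalerBr opprD addrACA.
  rewrite Dder ractDl -ractA mulb1 lactBr lractA.
  by rewrite opprD addrACA subrr add0r.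
split=> // a b.
rewrite -[LHS](subrK (lact u (d (a *b b)))) Wmul.
rewrite -[X in _ + lact u X](subrK (ract (d (a *b b)) u)) Umul.
set U := lact a _.
rewrite lactDr -lractA local_derivation_compressed// -lactA mul1b.
by rewrite /U ractBl lactBr -lractA [X in _ + X]addrA subrK addrCA subrK addrC.
Qed.

End LocalMaps.
End SpannedByIdempotents.

(** * Left multipliers as derivations *)

Definition without_left_action (K : numFieldType) (A : banachAlgType K)
  (M : banachBimodType A) : Type := M.

Section WithoutLeftAction.
Context {K : numFieldType} {A : banachAlgType K} {M : banachBimodType A}.
Local Notation N := (without_left_action M).

HB.instance Definition _ := CompleteNormedModule.on N.

Let lact_zero (a : A) (m : N) : N := 0.
Let ract_same (m : N) (a : A) : N := ract (m : M) a.

Let lact_zero_linearl m : linear (lact_zero ^~ m).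
Proof. by move=> k x y; rewrite /lact_zero scaler0 addr0. Qed.

Let lact_zero_linearr a : linear (lact_zero a).
Proof. by move=> k x y; rewrite /lact_zero scaler0 addr0. Qed.

Let ract_same_linearl a : linear (ract_same ^~ a).
Proof. exact: (@ract_linearl _ _ M). Qed.

Let ract_same_linearr m : linear (ract_same m).
Proof. exact: (@ract_linearr _ _ M). Qed.

Let lact_zeroA a b m : lact_zero (a *b b) m = lact_zero a (lact_zero b m).
Proof. by []. Qed.

Let ract_sameA m a b : ract_same m (a *b b) = ract_same (ract_same m a) b.
Proof. exact: (@ractA _ _ M). Qed.

Let lract_zeroA a m b : ract_same (lact_zero a m) b = lact_zero a (ract_same m b).
Proof. exact: (@ract0l _ _ M). Qed.

Let norm_act_zero : exists k : K, forall a m,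
  `|lact_zero a m| <= k * `|a| * `|m| /\ `|ract_same m a| <= k * `|a| * `|m|.
Proof.
have [k kM] := @norm_act _ _ M; exists k => a m; have [_ h] := kM a m.
by split=> //; rewrite normr0 (le_trans _ h).
Qed.

HB.instance Definition _ := CompleteNormedModule_isBanachBimodule.Build K A N
  lact_zero_linearl lact_zero_linearr ract_same_linearl ract_same_linearr
  lact_zeroA ract_sameA lract_zeroA norm_act_zero.

Lemma left_multiplier_derivation (V : A -> M) :
  left_multiplier V <-> derivation (V : A -> N).
Proof.
by split=> -[VL Vm]; split=> // a b; have := Vm a b; rewrite [lact a _]/(0 : M) addr0.
Qed.

End WithoutLeftAction.

Lemma local_derivations_local_left_multipliers (K : numFieldType)
    (A : banachAlgType K) :
  (forall (M : banachBimodType A) (d : A -> M),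
    bounded_operator d -> local_derivation d -> derivation d) ->
  forall (M : banachBimodType A) (V : A -> M),
    bounded_operator V -> local_left_multiplier V -> left_multiplier V.
Proof.
move=> dA M V Vb [VL Vloc]; apply/left_multiplier_derivation; apply: dA => //.
split=> // a; have [W Wl VW] := Vloc a.
by exists W => //; apply/left_multiplier_derivation.
Qed.

(** * Algebras acting on an ideal through the dual numbers *)

Definition regular_bimodule (K : numFieldType) (A : banachAlgType K) : Type := A.

Section RegularBimodule.
Context {K : numFieldType} {A : banachAlgType K}.
Local Notation N := (regular_bimodule A).

HB.instance Definition _ := CompleteNormedModule.on N.

Let lmul (a : A) (m : N) : N := a *b (m : A).
Let rmul (m : N) (a : A) : N := (m : A) *b a.

Let lmul_linearl m : linear (lmul ^~ m).
Proof. exact: (@bmul_linearl _ A). Qed.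

Let lmul_linearr a : linear (lmul a).
Proof. exact: (@bmul_linearr _ A). Qed.

Let rmul_linearl a : linear (rmul ^~ a).
Proof. exact: (@bmul_linearl _ A). Qed.

Let rmul_linearr m : linear (rmul m).
Proof. exact: (@bmul_linearr _ A). Qed.

Let lmulA a b m : lmul (a *b b) m = lmul a (lmul b m).
Proof. by rewrite /lmul bmulA. Qed.

Let rmulA m a b : rmul m (a *b b) = rmul (rmul m a) b.
Proof. exact: (@bmulA _ A). Qed.

Let lrmulA a m b : rmul (lmul a m) b = lmul a (rmul m b).
Proof. by rewrite /lmul /rmul bmulA. Qed.

Let norm_lrmul : exists k : K, forall a m,
  `|lmul a m| <= k * `|a| * `|m| /\ `|rmul m a| <= k * `|a| * `|m|.
Proof.
exists 1 => a m; rewrite mul1r; split; first exact: (@norm_bmul _ A).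
by rewrite mulrC; exact: (@norm_bmul _ A).
Qed.

HB.instance Definition _ := CompleteNormedModule_isBanachBimodule.Build K A N
  lmul_linearl lmul_linearr rmul_linearl rmul_linearr lmulA rmulA lrmulA norm_lrmul.

End RegularBimodule.

Lemma bounded_continuous (K : numFieldType) (V : normedModType K) (f : V -> K^o) :
  linear f -> (exists k : K, forall x, `|f x| <= k * `|x|) -> continuous f.
Proof.
move=> fL [k fk].
pose F := HB.pack_for {linear V -> K^o} f (GRing.isLinear.Build _ _ _ _ f fL).
apply: (@bounded_linear_continuous _ _ _ F); apply/ex_bound; exists `|k|.
apply/nbhs_norm0P; exists 1 => //= x /= x1; apply: le_trans (fk x) _.
have [->|x0] := eqVneq x 0; first by rewrite normr0 mulr0.
have k0 : 0 <= k.
  by have := le_trans (normr_ge0 _) (fk x); rewrite pmulr_lge0 // normr_gt0.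
by rewrite ger0_norm// ler_piMr// ltW.
Qed.

(** The elements X and Y span an ideal on which A acts as on the dual numbers,
    with X as 1, and Y as the element of square zero; t acts as that element. The
    functional g serves to read off the coefficient of Y. *)
Section DualNumberIdeal.
Context {K : numFieldType} {A : banachAlgType K}.
Hypothesis mulC : forall x y : A, x *b y = y *b x.
Variables (u t X Y : A) (g : A -> K^o) (c : K).
Hypotheses (gL : linear g) (gb : forall x, `|g x| <= c * `|x|) (gY : g Y = 1).
Hypothesis act : forall x, exists l m : K,
  x *b X = l *: X + m *: Y /\ x *b Y = l *: Y.
Hypotheses (uX : u *b X = X) (ut : u *b t = t) (tX : t *b X = Y) (tY : t *b Y = 0).

Definition chi (x : A) : K^o := g (x *b Y).

(** The coefficient of Y in xX = chi(x) X + pder(x) Y. The second term corrects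
    for g(X), which is arbitrary. *)
Definition pder (x : A) : K^o := g (x *b X) - g X * g (x *b Y).

Let gZ k x : g (k *: x) = k * g x. Proof. exact: linear_funZ. Qed.

Lemma act_chi x : x *b Y = chi x *: Y.
Proof.
by have [l [m [_ xY]]] := act x; rewrite /chi xY gZ gY mulr1.
Qed.

Lemma act_pder x : x *b X = chi x *: X + pder x *: Y.
Proof.
have [l [m [xX xY]]] := act x; rewrite {1}xX /chi /pder xX xY.
by rewrite (linear_funD gL) !gZ gY !mulr1 (mulrC (g X)) addrAC subrr add0r.
Qed.

Lemma Y_neq0 : Y != 0.
Proof. by apply: contra_eq_neq gY => ->; rewrite (linear_fun0 gL) eq_sym oner_eq0. Qed.

Lemma chi_linear : linear chi.
Proof. by move=> k x y; rewrite /chi bmulPl gL. Qed.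

Lemma pder_linear : linear pder.
Proof.
move=> k x y; rewrite /pder !bmulPl !gL mulrDr scalerBr opprD addrACA.
by congr (_ + _ + _); congr (- _); rewrite [LHS]mulrCA.
Qed.

Lemma gbmul_bounded (Z : A) : exists c' : K, forall x, `|g (x *b Z)| <= c' * `|x|.
Proof.
have c0 : 0 <= c.
  by have := le_trans (normr_ge0 _) (gb Y); rewrite pmulr_lge0 // normr_gt0 Y_neq0.
exists (c * `|Z|) => x; apply: le_trans (gb _) _.
by rewrite -mulrA ler_wpM2l// mulrC norm_bmul.
Qed.

Lemma pder_bounded : exists c' : K, forall x, `|pder x| <= c' * `|x|.
Proof.
have [a ha] := gbmul_bounded X; have [b hb] := gbmul_bounded Y.
exists (a + `|g X| * b) => x; apply: le_trans (ler_normB _ _) _.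
by rewrite mulrDl lerD// normrM -mulrA ler_wpM2l.
Qed.

Lemma chiM x y : chi (x *b y) = chi x * chi y.
Proof.
by rewrite {1}/chi -bmulA act_chi bmulZr act_chi scalerA gZ gY mulr1 mulrC.
Qed.

Lemma pder_u : pder u = 0 /\ chi u = 1.
Proof.
have uY : u *b Y = Y by rewrite -tX bmulA ut.
by rewrite /pder /chi uX uY gY mulr1 subrr.
Qed.

Lemma pder_t : pder t = 1 /\ chi t = 0.
Proof. by rewrite /pder /chi tX tY (linear_fun0 gL) gY mulr0 subr0. Qed.

Lemma pderM x y : pder (x *b y) = chi x * pder y + pder x * chi y.
Proof.
have := act_pder (x *b y); rewrite -bmulA act_pder bmulDr !bmulZr act_chi act_pder.
rewrite chiM scalerDr !scalerA (mulrC (chi y)) -addrA => /addrI.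
rewrite -scalerDl => /(congr1 g); rewrite !gZ gY !mulr1.
by rewrite addrC (mulrC (chi x)) (mulrC (chi y)) => <-.
Qed.

(** If xy = 0, then chi(x)chi(y) = 0 and chi(x)pder(y) + pder(x)chi(y) = 0, so
    chi(x)pder(y) = 0 in either case. A functional of the product would take the
    same value at (u, t) and (t, u), where this form is 1 and 0. *)
Lemma dual_number_not_zpd : ~ zero_product_determined A.
Proof.
move=> zpd; have chiC : continuous chi.
  by apply: bounded_continuous chi_linear (gbmul_bounded Y).
have pderC : continuous pder by apply: bounded_continuous pder_linear pder_bounded.
have [|||x y xy0|tau [_ _ htau]] := zpd (fun x y => chi x * pder y).
- by move=> y k x z; rewrite chi_linear mulrDl -mulrA.
- by move=> x k y z; rewrite pder_linear mulrDr; congr (_ + _); exact: mulrCA.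
- move=> p; apply: (@cvgM _ _ _ _ (chi \o fst) (pder \o snd)).
    by apply: continuous_comp; [exact: cvg_fst|exact: chiC].
  by apply: continuous_comp; [exact: cvg_snd|exact: pderC].
- have := chiM x y; have := pderM x y; rewrite xy0.
  rewrite (linear_fun0 chi_linear) (linear_fun0 pder_linear) => D0 /esym/eqP.
  rewrite mulf_eq0 => /orP[/eqP->|/eqP y0]; first by rewrite mul0r.
  by rewrite D0 y0 mulr0 addr0.
have := htau u t; rewrite mulC -htau.
have [-> ->] := pder_u; have [-> ->] := pder_t.
by move/eqP; rewrite mul1r mulr0 oner_eq0.
Qed.

Definition pderY (x : A) : regular_bimodule A := pder x *: Y.

Lemma pderY_linear : linear pderY.
Proof. by move=> k x y; rewrite /pderY pder_linear scalerDl scalerA. Qed.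

Lemma pderY_bounded : bounded_operator pderY.
Proof.
have [k kb] := pder_bounded; exists (k * `|Y|) => x.
by rewrite /pderY normrZ mulrAC ler_wpM2r.
Qed.

(** The values of x |-> pder(x) Y lie in xA, but the cofactor of x cannot be
    chosen once for all: it is a multiple of Y when chi(x) is nonzero, and X
    otherwise. *)
Lemma pderY_local x : exists Z : A, pderY x = x *b Z.
Proof.
have [x0|x0] := eqVneq (chi x) 0.
  by exists X; rewrite act_pder x0 scale0r add0r.
by exists ((chi x)^-1 * pder x *: Y); rewrite
  bmulZr act_chi scalerA mulrAC mulVf// mul1r.
Qed.

Lemma dual_number_right_multiplier :
  local_right_multiplier pderY /\ ~ right_multiplier pderY.
Proof.
split.
  split=> [|x]; first exact: pderY_linear.
  have [Z ->] := pderY_local x; exists (fun a => a *b Z : regular_bimodule A) => //.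
  split=> [k a b|a b]; first exact: bmulPl.
  by rewrite -bmulA.
move=> [_ /(_ t u)]; rewrite mulC ut /pderY.
have [-> _] := pder_t; have [-> _] := pder_u.
by rewrite scale1r scale0r lact0 => /eqP; rewrite (negPf Y_neq0).
Qed.

Lemma dual_number_left_multiplier :
  local_left_multiplier pderY /\ ~ left_multiplier pderY.
Proof.
split.
  split=> [|x]; first exact: pderY_linear.
  have [Z ->] := pderY_local x; rewrite mulC.
  exists (fun a => Z *b a : regular_bimodule A) => //.
  split=> [k a b|a b]; first exact: bmulPr.
  by rewrite bmulA.
move=> [_ /(_ u t)]; rewrite ut /pderY.
have [-> _] := pder_t; have [-> _] := pder_u.
by rewrite scale1r scale0r ract0l => /eqP; rewrite (negPf Y_neq0).
Qed.

End DualNumberIdeal.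

(** * The algebra generated by a matrix *)

Section FunctionalsOnMatrices.
Context {R : realType} {n : nat}.
Local Notation C := R[i].

Lemma norm_entry_le (X : opmx R n) i j : `|X i j : C| <= `|X|.
Proof.
rewrite opmx_normE (_ : `|X i j : C| = (ComplexField.Normc.normc (X i j))%:C%C).
  by rewrite lecR; exact: normc_le_opnorm.
by case: (X i j).
Qed.

Lemma opmx_linear_bounded (f : opmx R n -> C^o) : linear f ->
  exists k : C, forall X, `|f X| <= k * `|X|.
Proof.
move=> fL; exists (\sum_i \sum_j `|f (delta_mx i j)|) => X.
pose F := HB.pack_for {linear opmx R n -> C^o} f (GRing.isLinear.Build _ _ _ _ f fL).
have -> : f X = \sum_i \sum_j X i j * f (delta_mx i j).
  rewrite -[f]/(F : _ -> _) {1}[X]matrix_sum_delta linear_sum; apply: eq_bigr => i _.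
  by rewrite linear_sum; apply: eq_bigr => j _; rewrite linearZ.
apply: le_trans (ler_norm_sum _ _ _) _; rewrite mulr_suml; apply: ler_sum => i _.
apply: le_trans (ler_norm_sum _ _ _) _; rewrite mulr_suml; apply: ler_sum => j _.
by rewrite normrM mulrC ler_wpM2l// norm_entry_le.
Qed.

(** Row spaces are the finite-dimensional subspaces of matrices; a row space is
    an intersection of kernels of linear functionals, which are continuous. *)
Lemma closed_rowspace m (B : 'M[C]_(m, n * n)) :
  closed [set X : opmx R n | (mxvec X <= B)%MS].
Proof.
have -> : [set X : opmx R n | (mxvec X <= B)%MS] =
    \bigcap_j [set X : opmx R n | (mxvec X *m cokermx B) 0 j = 0 :> C^o].
  apply/seteqP; split => X /=.
    by rewrite submxE => /eqP XB j _ /=; rewrite XB mxE.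
  move=> XB; rewrite submxE; apply/eqP/matrixP => i j.
  by rewrite (ord1 i) (XB j I) mxE.
apply: closed_bigI => j _.
apply: (@closed_comp _ _
  (fun X : opmx R n => (mxvec X *m cokermx B) 0 j : C^o) [set 0]).
  move=> X _; apply: bounded_continuous.
    by move=> k Y Z; rewrite linearP mulmxDl -scalemxAl !mxE.
  by apply: opmx_linear_bounded => k Y Z; rewrite linearP mulmxDl -scalemxAl !mxE.
exact: accessible_closed_set1 (hausdorff_accessible (@norm_hausdorff _ C^o)) _.
Qed.

End FunctionalsOnMatrices.

Section PolynomialsInT.
Context {R : realType} {n : nat}.
Local Notation C := R[i].
Variable T : 'M[C]_n.+1.
Local Notation AT := (algebra_generated_by T).

(** The polynomials in T form a subalgebra, closed because they are the row space
    of finitely many powers of T. *)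
Lemma generated_horner_mx (X : 'M[C]_n.+1) :
  subalg_set (generated [set (T : opmx R n.+1); (1%:M : opmx R n.+1)]) X <->
  exists p, X = horner_mx T p.
Proof.
set G := [set _; _]; split.
  pose P := [set Y : opmx R n.+1 | exists p, Y = horner_mx T p].
  have GP : G `<=` P.
    move=> Y [->|->]; first by exists 'X; rewrite horner_mx_X.
    by exists 1; rewrite [RHS]rmorph1.
  suff Pcl : closed_subalgebra P by exact: smallest_sub Pcl GP X.
  split.
  - rewrite (_ : P =
      [set X : opmx R n.+1 | (mxvec X <= powers_mx T (degree_mxminpoly T))%MS]).
      exact: closed_rowspace.
    apply/seteqP; split=> Y /=; first by move=> [p ->]; exact: horner_mx_mem.
    by move=> /mx_inv_hornerK <-; eexists.
  - by exists 0; rewrite rmorph0.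
  - by move=> k _ _ [p ->] [q ->]; exists (k *: p + q); rewrite linearP.
  - by move=> _ _ [p ->] [q ->]; exists (p * q); rewrite rmorphM.
move=> [p ->]; have [_ S0 SL SM] := Defs.subalg_closed (generated G).
have SG : G `<=` subalg_set (generated G) by exact: sub_smallest.
elim/poly_ind: p => [|p k IHp]; first by rewrite rmorph0.
rewrite rmorphD rmorphM /= horner_mx_X horner_mx_C -scalemx1 addrC.
by apply: SL; [apply: SG; right|apply: SM => //; apply: SG; left].
Qed.

Lemma horner_subproof p : (horner_mx T p : opmx R n.+1) \in
  subalg_pred (generated [set (T : opmx R n.+1); (1%:M : opmx R n.+1)]).
Proof. by apply/asboolP/generated_horner_mx; exists p. Qed.

Definition poly_at p : AT := Subalg (horner_subproof p).

Lemma poly_at_onto (x : AT) : exists p, x = poly_at p.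
Proof.
have /asboolP/generated_horner_mx[p xp] := valP x.
by exists p; apply/val_inj.
Qed.

Lemma poly_at_linear : linear poly_at.
Proof. by move=> k p q; apply/val_inj; rewrite /= linearP. Qed.

Lemma poly_atM p q : poly_at (p * q) = poly_at p *b poly_at q.
Proof. by apply/val_inj; rewrite /= rmorphM. Qed.

Lemma poly_at_eq0 p : poly_at p = 0 <-> mxminpoly T %| p.
Proof.
split=> [/(congr1 val) /= /mxminpoly_min//|/mxminpoly_minP pT0].
exact/val_inj.
Qed.

Lemma algebra_mulC (x y : AT) : x *b y = y *b x.
Proof.
have [p ->] := poly_at_onto x; have [q ->] := poly_at_onto y.
by rewrite -!poly_atM mulrC.
Qed.

Lemma algebra_mul1b (x : AT) : poly_at 1 *b x = x.
Proof. by have [p ->] := poly_at_onto x; rewrite -poly_atM mul1r. Qed.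

Lemma algebra_mulb1 (x : AT) : x *b poly_at 1 = x.
Proof. by rewrite algebra_mulC algebra_mul1b. Qed.

(** With rs the distinct roots of a multiple of the minimal polynomial,
    polynomials that agree on rs have the same value at T. Thus
    p(T) = \sum_(a in rs) p(a) l_a(T) for the Lagrange polynomials l_a, and l_a(T)
    is idempotent because l_a is 0 or 1 on rs. *)
Lemma diagonalizable_idempotent_span : diagonalizable T ->
  forall x : AT, idempotent_span x.
Proof.
move=> /diagonalizableP[rs rs_uniq Trs] x; have [p ->] := poly_at_onto x.
have vanish q : (forall a, a \in rs -> q.[a] = 0) -> poly_at q = 0.
  move=> q0; apply/poly_at_eq0; apply: dvdp_trans Trs _.
  apply: uniq_roots_dvdp; last by rewrite uniq_rootsE.
  by apply/allP => a ars; apply/eqP/q0.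
pose l a : {poly C} := \prod_(b <- rs | b != a) ((a - b)^-1 *: ('X - b%:P)).
have lE a b : b \in rs -> (l a).[b] = (b == a)%:R.
  move=> brs; rewrite horner_prod; have [->|ba] := eqVneq b a.
    rewrite big1 // => c ca; rewrite !hornerE mulVf// subr_eq0 eq_sym.
    exact: ca.
  apply/eqP; rewrite prodf_seq_eq0; apply/hasP; exists b => //=.
  by rewrite ba !hornerE subrr mulr0 eqxx.
have -> : poly_at p = poly_at (\sum_(a <- rs) p.[a] *: l a).
  apply/eqP; rewrite -subr_eq0 -(linear_funB poly_at_linear); apply/eqP/vanish => b brs.
  rewrite !hornerE horner_sum (bigD1_seq b)//= big1 => [|c cb].
    by rewrite !hornerE lE// eqxx mulr1 ?addr0 subrr.
  by rewrite !hornerE lE// eq_sym (negPf cb) mulr0.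
elim: (X in \sum_(a <- X) _) => [|a s IHs].
  by rewrite big_nil (linear_fun0 poly_at_linear); constructor.
rewrite big_cons poly_at_linear; constructor=> //.
apply/eqP; rewrite -poly_atM -subr_eq0 -(linear_funB poly_at_linear).
apply/eqP/vanish => b brs; rewrite !hornerE lE//.
by case: eqP => _; rewrite ?mulr1 ?mulr0 subrr.
Qed.

(** The field C is algebraically closed, so the minimal polynomial is a product of
    linear factors, with a repetition if T is not diagonalizable. *)
Lemma not_diagonalizable_double_root : ~ diagonalizable T ->
  exists a q, mxminpoly T = ('X - a%:P) * (('X - a%:P) * q).
Proof.
move=> Tnd; have [rs] := closed_field_poly_normal (mxminpoly T).
rewrite (eqP (mxminpoly_monic T)) scale1r => Trs.
have : ~~ uniq rs.
  by apply/negP => rsu; apply/Tnd/diagonalizableP; exists rs; rewrite ?Trs.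
move: Trs; elim: rs (mxminpoly T) => [//|a s IHs] f /= ->.
rewrite big_cons negb_and negbK; case: (boolP (a \in s)) => /= [as_ _|_ su].
  exists a, (\prod_(b <- rem a s) ('X - b%:P)).
  by rewrite (big_rem a).
have [b [q ->]] := IHs _ erefl su; exists b, (('X - a%:P) * q).
by rewrite mulrCA; congr (_ * _); rewrite mulrCA.
Qed.

Lemma poly_mod_sqr (a : C) p : exists l m r,
  p = l%:P + ('X - a%:P) * (m%:P + ('X - a%:P) * r).
Proof.
have peel q : exists l r, q = l%:P + ('X - a%:P) * r.
  have /factor_theorem[r qr] : root (q - q.[a]%:P) a by rewrite /root !hornerE subrr.
  by exists q.[a], r; rewrite mulrC -qr addrC subrK.
by have [l [s ->]] := peel p; have [m [r ->]] := peel s; exists l, m, r.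
Qed.

(** With (x - a)^2 q the minimal polynomial, t = T - a, X = q(T) and Y = tX. Then
    Y is nonzero, as (x - a) q has smaller degree than the minimal polynomial, and
    p(T) acts on the span of X and Y through p modulo (x - a)^2. The functional g
    reads, up to scaling, an entry of its argument at which Y is nonzero. *)
Lemma not_diagonalizable_dual_numbers : ~ diagonalizable T ->
  exists (t X Y : AT) (g : AT -> C^o) (c : C),
  [/\ linear g, forall x, `|g x| <= c * `|x| & g Y = 1] /\
  [/\ forall x, exists l m : C, x *b X = l *: X + m *: Y /\ x *b Y = l *: Y,
      t *b X = Y & t *b Y = 0].
Proof.
move=> /not_diagonalizable_double_root[a [q Taq]].
have T0 : mxminpoly T != 0 by exact/monic_neq0/mxminpoly_monic.
pose t := poly_at ('X - a%:P); pose X := poly_at q; pose Y := poly_at (('X - a%:P) * q).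
have tX : t *b X = Y by rewrite -poly_atM.
have tY : t *b Y = 0 by rewrite -poly_atM; apply/poly_at_eq0; rewrite Taq.
have Y0 : Y <> 0.
  move/poly_at_eq0; rewrite Taq => Y0.
  have q0 : ('X - a%:P) * q != 0.
    by apply: contra_neq T0; rewrite Taq => ->; rewrite mulr0.
  have := dvdp_leq q0 Y0.
  by rewrite [X in (X <= _)%N]size_monicM ?monicXsubC// size_XsubC ltnn.
have [i [j Yij]] : exists i j, (val Y : 'M[C]_n.+1) i j != 0.
  apply: contra_notP Y0 => Y0; apply/val_inj/matrixP => i j; rewrite [RHS]mxE.
  by apply/eqP/negPn/negP => Yij; apply: Y0; exists i, j.
pose g (Z : opmx R n.+1) : C^o := Z i j / (val Y : 'M[C]_n.+1) i j.
have gL : linear g by move=> k U V; rewrite /g !mxE mulrDl -mulrA.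
have [c gb] := opmx_linear_bounded gL.
exists t, X, Y, (fun Z => g (val Z)), c; split; split;
  [|by move=> Z; exact: gb|exact: divff| |exact: tX|exact: tY].
  by move=> k U V; rewrite linearP gL.
move=> x; have [p ->] := poly_at_onto x; have [l [m [r ->]]] := poly_mod_sqr a p.
have XsubE : poly_at (l%:P + ('X - a%:P) * (m%:P + ('X - a%:P) * r)) =
    l *: poly_at 1 + t *b (m *: poly_at 1 + t *b poly_at r).
  rewrite -poly_atM -!poly_at_linear -poly_atM -poly_at_linear.
  by rewrite !alg_polyC.
exists l, m; rewrite XsubE !bmulDl !bmulZl !algebra_mul1b; split.
  rewrite algebra_mulC bmulA (algebra_mulC X) tX bmulDr bmulZr algebra_mulb1.
  by rewrite bmulA (algebra_mulC Y) tY bmul0r addr0.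
by rewrite algebra_mulC bmulA (algebra_mulC Y) tY bmul0r addr0.
Qed.

End PolynomialsInT.

(** * The equivalence *)

Theorem theorem1 (R : realType) (n : nat) (hn : (2 <= n)%N) (T : 'M[R[i]]_n) :
  [<->
    (* (i) *)
    zero_product_determined (algebra_generated_by T);
    (* (ii) *)
    forall (M : banachBimodType (algebra_generated_by T))
           (d : algebra_generated_by T -> M),
      bounded_operator d -> local_derivation d -> derivation d;
    (* (iii), left multipliers *)
    forall (M : banachBimodType (algebra_generated_by T))
           (V : algebra_generated_by T -> M),
      bounded_operator V -> local_left_multiplier V -> left_multiplier V;
    (* (iii), right multipliers *)
    forall (M : banachBimodType (algebra_generated_by T))
           (V : algebra_generated_by T -> M),
      bounded_operator V -> local_right_multiplier V -> right_multiplier V;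
    (* (iv) *)
    diagonalizable T].
Proof.
case: n hn T => [//|n _] T; pose u := poly_at T 1.
have mul1b : forall x, u *b x = x by exact: algebra_mul1b.
have mulb1 : forall x, x *b u = x by exact: algebra_mulb1.
have mulC := @algebra_mulC R n T.
split; last split; last split; last split.
- move=> zpd M d _; apply: (idempotent_span_derivation mul1b mulb1).
  apply: diagonalizable_idempotent_span; apply: contrapT.
  move=> /not_diagonalizable_dual_numbers[t [X [Y [g [c [[gL gb gY] [act tX tY]]]]]]].
  exact: (dual_number_not_zpd mulC gL gb gY act (mul1b X) (mul1b t) tX tY zpd).
- exact: local_derivations_local_left_multipliers.
(* Commutativity makes one map a local left and a local right multiplier, so
   left multipliers detect diagonalizability as well as right ones. *)
- move=> left M V _; apply: (idempotent_span_right_multiplier mul1b mulb1).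
  apply: diagonalizable_idempotent_span; apply: contrapT.
  move=> /not_diagonalizable_dual_numbers[t [X [Y [g [c [[gL gb gY] [act tX tY]]]]]]].
  have [Vloc []] :=
    dual_number_left_multiplier mulC gL gY act (mul1b X) (mul1b t) tX tY.
  by apply: left Vloc; exact: pderY_bounded gL gb gY.
- move=> right; apply: contrapT.
  move=> /not_diagonalizable_dual_numbers[t [X [Y [g [c [[gL gb gY] [act tX tY]]]]]]].
  have [Vloc []] :=
    dual_number_right_multiplier mulC gL gY act (mul1b X) (mul1b t) tX tY.
  by apply: right Vloc; exact: pderY_bounded gL gb gY.
- move=> /diagonalizable_idempotent_span idemA.
  exact: (idempotent_span_zpd mul1b mulb1 idemA).
Qed.
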